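(* Let $u:\mathbb{R}\to\mathbb{R}$ be a smooth periodic function, $M>0$, $T>0$, $I=[0,T]$, and for $\varepsilon\in(0,1)$ let $\mu_\varepsilon(T)$ be the Lebesgue measure of the set $J_\varepsilon=\{t\in I:\ |u(t)|\le\varepsilon M\}$. If $u$ has only simple roots on $I$, then there is a constant $C>0$, independent of $\varepsilon$, such that $\mu_\varepsilon(T)\le C\varepsilon T$. More generally, if $u$ also has double roots (all roots of $u$ on $I$ being simple or double), then there is a constant $C>0$, independent of $\varepsilon$, such that $\mu_\varepsilon(T)\le C\sqrt\varepsilon\,T$.
   Context: A root $t_0$ of $u$ is simple if $u(t_0)=0$ and $\dot u(t_0)\ne0$, and double if $u(t_0)=\dot u(t_0)=0$ and $\ddot u(t_0)\neq0$. *)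

(* Defs.v *)
From mathcomp Require Import all_boot all_order all_algebra.
From mathcomp Require Import all_classical all_reals all_analysis.
Set Implicit Arguments.
Unset Strict Implicit.
Unset Printing Implicit Defensive.

Import Order.TTheory GRing.Theory Num.Theory.
Import numFieldNormedType.Exports.

Local Open Scope ring_scope.
(* Opened last: in ring_scope, u^`() and u^`(n) denote derivatives of polynomials. *)
Local Open Scope classical_set_scope.

Definition smooth (R : realType) (u : R -> R) : Prop :=
  forall (n : nat) (t : R), derivable (u^`(n)) t 1.

Definition simple_root (R : realType) (u : R -> R) (t0 : R) : Prop :=
  u t0 = 0 /\ u^`() t0 <> 0.

Definition double_root (R : realType) (u : R -> R) (t0 : R) : Prop :=
  [/\ u t0 = 0, u^`() t0 = 0 & u^`(2) t0 <> 0].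

Definition sublevel (R : realType) (u : R -> R) (M T eps : R) : set R :=
  [set t | 0 <= t <= T /\ `|u t| <= eps * M].

Definition mu_eps (R : realType) (u : R -> R) (M T eps : R) : \bar R :=
  lebesgue_measure (sublevel u M T eps).

(* Main.v *)
Require Import Defs.
From mathcomp Require Import all_boot all_order all_algebra.
From mathcomp Require Import finmap.
From mathcomp Require Import all_classical all_reals all_analysis.
Set Implicit Arguments.
Unset Strict Implicit.
Unset Printing Implicit Defensive.

Import Order.TTheory GRing.Theory Num.Theory.
Import numFieldNormedType.Exports.

Local Open Scope ring_scope.
Local Open Scope classical_set_scope.

(** Close to a root of order at most [k], a function can be small only very near
    that root.  Indeed a bound [c * |t - a| ^ k <= |u t|] with [c > 0], valid
    near [a], forces every [t] near [a] with [|u t| <= s ^ k * M] to lie within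
    [K * s] of [a], where [K] depends on [a] but not on [s].  If every [a] in
    [[0, T]], root or not, has a neighbourhood with such a bound, then finitely
    many of them suffice by compactness, and the sublevel set is covered by
    finitely many intervals of length [2 * K_i * s]: its measure is [O(s)]
    ([sublevel_measure_le]).  The two bounds of the theorem are the cases
    [k = 1], [s = eps] and [k = 2], [s = sqrt eps].

    The lower bounds near the roots come from integrating lower bounds on the
    derivatives.  A function which is continuous and nonzero at [a] vanishes
    there to order at most 0 ([vanish_order0]), and if [f a = 0] then the order
    goes up by at most one from the derivative of [f] to [f]
    ([vanish_order_primitive]).  So a simple root has order at most 1 and a
    double root order at most 2. *)

(** The order is expressed by an inequality rather than by the nonvanishing of
    a derivative, so that nonroots, simple roots and double roots can all be
    handled with one exponent. *)
Definition vanishes_to_order_at_most (R : realType) (k : nat) (f : R -> R)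
    (a : R) : Prop :=
  exists c r : R, [/\ 0 < c, 0 < r &
    forall t, `|t - a| < r -> c * `|t - a| ^+ k <= `|f t|].

Lemma vanish_order0 (R : realType) (f : R -> R) (a : R) :
  {for a, continuous f} -> f a <> 0 -> vanishes_to_order_at_most 0 f a.
Proof.
move=> fa /eqP fa0; have c0 : 0 < `|f a| / 2 by rewrite divr_gt0 ?normr_gt0.
have /cvgrPdist_lt/(_ _ c0)/nbhs_ballP[r /= r0 rb] := fa.
exists (`|f a| / 2), r; split => // t tr; rewrite expr0 mulr1.
have ft : `|f a - f t| < `|f a| / 2 by apply: rb; rewrite /ball /= distrC.
have := lerB_dist (f a) (f a - f t); rewrite opprB addrCA subrr addr0.
by apply: le_trans; rewrite lerBrDr {2}(splitr `|f a|) lerD2l ltW.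
Qed.

Lemma vanish_order_leq (R : realType) (j k : nat) (f : R -> R) (a : R) :
  (j <= k)%N -> vanishes_to_order_at_most j f a ->
  vanishes_to_order_at_most k f a.
Proof.
move=> jk [c [r [c0 r0 H]]]; exists c, (Num.min r 1).
split=> //; first by rewrite lt_min r0 ltr01.
move=> t; rewrite lt_min => /andP[tr t1]; apply: le_trans (H t tr).
by rewrite ler_pM2l// ler_wiXn2l// ltW.
Qed.

(** By Cauchy's mean value theorem, [f t / (t - a) ^ k.+1] equals
    [f' x / (k.+1 * (x - a) ^ k)] for some [x] strictly between [a] and [t].
    The plain mean value theorem [f t = f' x * (t - a)] would not do for
    [0 < k]: [x] may be so close to [a] that the bound on [f' x] is useless. *)
Lemma vanish_order_primitive (R : realType) (k : nat) (f : R -> R) (a : R) :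
  (forall t, derivable f t 1) -> f a = 0 ->
  vanishes_to_order_at_most k f^`() a -> vanishes_to_order_at_most k.+1 f a.
Proof.
move=> df fa0 [c [r [c0 r0 H]]].
exists (c / k.+1%:R), r; split=> // [|t tr]; first by rewrite divr_gt0.
pose g (x : R) := (x - a) ^+ k.+1.
pose dg (x : R) := k.+1%:R * (x - a) ^+ k.
have gdg (x : R) : is_derive x 1 g (dg x).
  rewrite (_ : g = (id - cst a) ^+ k.+1); last first.
    by apply/funext => y; rewrite exprfctE.
  by apply: is_derive_eq; rewrite /dg subr0 /GRing.scale/= mulr1.
have fdf (x : R) : is_derive x 1 f (f^`() x).
  by rewrite derive1E; apply/derivableP/df.
have cont (h dh : R -> R) (x y : R) :
    (forall z : R, is_derive z 1 h (dh z)) -> {within `[x, y], continuous h}.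
  move=> hd; apply: derivable_within_continuous => z _.
  exact: (@ex_derive _ _ _ _ _ _ _ (hd z)).
have ga0 : g a = 0 by rewrite /g subrr expr0n.
have [->|ta0] := eqVneq t a; first by rewrite subrr normr0 expr0n mulr0.
suff [x [xa xt ->]] : exists x : R, [/\ x != a, `|x - a| <= `|t - a| &
    f t = f^`()%classic x / dg x * g t].
  have xa0 : 0 < `|x - a| ^+ k by rewrite exprn_gt0// normr_gt0 subr_eq0.
  have Hx := H x (le_lt_trans xt tr).
  rewrite /g /dg normrM normrX ler_wpM2r ?exprn_ge0//.
  rewrite normf_div normrM normrX normr_nat ler_pdivlMr ?mulr_gt0//.
  by rewrite mulrA divfK ?pnatr_eq0.
have dg0 (x : R) : x != a -> dg x != 0.
  by move=> xa; rewrite mulf_neq0 ?pnatr_eq0// expf_neq0// subr_eq0.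
have gt0 : g t != 0 by rewrite expf_neq0// subr_eq0.
have [ta|ta|/eqP] := ltgtP t a; last by rewrite (negPf ta0).
- have [x|x] := cauchy_MVT ta (cont _ _ t a fdf) (cont _ _ t a gdg)
    (fun x _ => fdf x) (fun x _ => gdg x).
    by rewrite in_itv/= => /andP[_ ax]; rewrite dg0// lt_eqF.
  rewrite in_itv/= => /andP[tx xa] E; exists x.
  rewrite lt_eqF// E fa0 ga0 !sub0r invrN mulrNN divfK ?gt0//.
  by rewrite !ltr0_norm ?subr_lt0// lerN2 lerD2r ltW.
- have [x|x] := cauchy_MVT ta (cont _ _ a t fdf) (cont _ _ a t gdg)
    (fun x _ => fdf x) (fun x _ => gdg x).
    by rewrite in_itv/= => /andP[ax _]; rewrite dg0// gt_eqF.
  rewrite in_itv/= => /andP[ax xt] E; exists x.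
  rewrite gt_eqF// E fa0 ga0 !subr0 divfK ?gt0//.
  by rewrite !gtr0_norm ?subr_gt0// lerD2r ltW.
Qed.

(** Powers [s ^ k] parametrize the levels so that no [k]-th root has to be
    taken: the bound is linear in [s]. *)
Lemma sublevel_measure_le (R : realType) (k : nat) (u : R -> R) (M T : R) :
  (0 < k)%N -> 0 < M -> continuous u ->
  (forall t, 0 <= t <= T -> vanishes_to_order_at_most k u t) ->
  exists C : R, 0 < C /\ forall s : R, 0 < s ->
    (mu_eps u M T (s ^+ k) <= (C * s)%:E)%E.
Proof.
move=> k0 M0 cu H.
have : forall a, exists rK : R * R, 0 <= a <= T ->
    [/\ 0 < rK.1, 0 < rK.2 & forall s t, 0 < s -> `|t - a| < rK.1 ->
      `|u t| <= s ^+ k * M -> `|t - a| <= rK.2 * s].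
  move=> a; have [aT|aT] := boolP (0 <= a <= T); last by exists (0, 0).
  have [c [r [c0 r0 lb]]] := H a aT.
  (* Any K with M / c <= K ^ k will do; M / c + 1 is one, since it is at
     least 1 and so at most its own k-th power. *)
  have K1 : 1 <= M / c + 1 by rewrite lerDr divr_ge0// ltW.
  have K0 : 0 < M / c + 1 by exact: lt_le_trans K1.
  exists (r, M / c + 1) => _; split=> // s t s0 tr us.
  rewrite -(@ler_pXn2r _ k)// ?nnegrE ?mulr_ge0 ?(ltW K0) ?(ltW s0)//=.
  rewrite exprMn mulrC.
  have := le_trans (lb t tr) us.
  rewrite [c * _]mulrC -ler_pdivlMr// => /le_trans.
  apply; rewrite -mulrA ler_pM2l ?exprn_gt0//.
  by apply: le_trans (ler_eXnr k0 K1); rewrite lerDl.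
move=> /choice[rK HrK].
have : cover_compact `[0, T].
  rewrite -compact_cover; exact: segment_compact.
move=> /(_ R `[0, T] (fun a => ball a (rK a).1)) [].
- by move=> a _; exact: ball_open.
- move=> a /= aT; exists a => //; apply: ballxx.
  by move: aT; rewrite in_itv/= => /HrK[].
move=> D DT Dcov.
have D_itv (a : R) : [set` D] a -> 0 <= a <= T.
  by move=> /DT; rewrite inE/= in_itv.
have S0 : 0 <= \sum_(a \in [set` D]) (rK a).2 *+ 2.
  by apply: fsumr_ge0 => a /D_itv/HrK[_ K0 _]; rewrite mulrn_wge0// ltW.
exists (\sum_(a \in [set` D]) (rK a).2 *+ 2 + 1).
split; first exact: ltr_wpDl.
move=> s s0.
have msub : measurable (sublevel u M T (s ^+ k)).
  apply: measurable_realfun.closed_measurable; rewrite (_ : sublevel _ _ _ _ =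
    `[0, T] `&` u @^-1` `[- (s ^+ k * M), s ^+ k * M]).
    apply: closedI; first exact: itv_closed.
    by apply: preimage_closed => [t _|]; [exact: cu|exact: itv_closed].
  by apply/seteqP; split=> t; rewrite /sublevel /= !in_itv/= ler_norml.
have cov : sublevel u M T (s ^+ k) `<=`
    \bigcup_(a in [set` D]) closed_ball a ((rK a).2 * s).
  move=> t [tT us]; have [|a aD at_] := Dcov t; first by rewrite /= in_itv.
  have [_ K0 near_a] := HrK a (D_itv a aD).
  exists a => //; rewrite closed_ballE ?mulr_gt0// /closed_ball_ /= distrC.
  by apply: near_a => //; rewrite distrC.
apply: le_trans (content_sub_fsum lebesgue_measure (finite_fset D) _ msub cov) _.
  by move=> a _; exact: measurable_realfun.measurable_closed_ball.
rewrite (eq_fsbigr (fun a => ((rK a).2 *+ 2 * s)%:E)).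
  by rewrite fsumEFin// lee_fin -mulr_fsuml ler_pM2r// lerDl ler01.
move=> a; rewrite inE => /D_itv/HrK[_ K0 _].
apply: etrans (lebesgue_measure_closed_ball _ _) _; last by rewrite mulrnAl.
by rewrite mulr_ge0// ltW.
Qed.

Theorem lemma2 (R : realType) (u : R -> R) (M T : R)
    (u_smooth : smooth u)
    (u_periodic : exists p : R, 0 < p /\ periodic u p)
    (M_gt0 : 0 < M) (T_gt0 : 0 < T) :
  ((forall t : R, 0 <= t <= T -> u t = 0 -> simple_root u t) ->
     exists C : R, 0 < C /\
       forall eps : R, 0 < eps -> eps < 1 ->
         (mu_eps u M T eps <= (C * eps * T)%:E)%E)
  /\
  ((forall t : R, 0 <= t <= T -> u t = 0 ->
       simple_root u t \/ double_root u t) ->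
     exists C : R, 0 < C /\
       forall eps : R, 0 < eps -> eps < 1 ->
         (mu_eps u M T eps <= (C * Num.sqrt eps * T)%:E)%E).
Proof.
have cont n : continuous (u^`(n)).
  by move=> t; exact/differentiable_continuous/derivable1_diffP/u_smooth.
have order0 t : u t <> 0 -> vanishes_to_order_at_most 0 u t.
  by apply: vanish_order0; exact: (cont 0).
have order1 t : simple_root u t -> vanishes_to_order_at_most 1 u t.
  move=> [ut0 dut]; apply: vanish_order_primitive => //.
    exact: (u_smooth 0).
  by apply: vanish_order0 => //; exact: (cont 1).
have order2 t : double_root u t -> vanishes_to_order_at_most 2 u t.
  move=> [ut0 dut ddut]; apply: vanish_order_primitive => //.
    exact: (u_smooth 0).
  apply: vanish_order_primitive => //.
    exact: (u_smooth 1).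
  by apply: vanish_order0 => //; exact: (cont 2).
split=> roots.
- have [|C [C0 HC]] := @sublevel_measure_le R 1 u M T isT M_gt0 (cont 0).
    move=> t tT; have [ut0|/order0] := pselect (u t = 0).
      exact: order1 (roots t tT ut0).
    exact: vanish_order_leq.
  exists (C / T); split=> [|eps eps0 _]; first exact: divr_gt0.
  have := HC eps eps0; rewrite expr1; congr (_ <= _%:E)%E.
  by rewrite mulrAC divfK// gt_eqF.
- have [|C [C0 HC]] := @sublevel_measure_le R 2 u M T isT M_gt0 (cont 0).
    move=> t tT; have [ut0|/order0] := pselect (u t = 0).
      have [/order1|/order2//] := roots t tT ut0.
      exact: vanish_order_leq.
    exact: vanish_order_leq.
  exists (C / T); split=> [|eps eps0 _]; first exact: divr_gt0.
  have := HC (Num.sqrt eps); rewrite sqrtr_gt0 sqr_sqrtr ?(ltW eps0)// => /(_ eps0).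
  by congr (_ <= _%:E)%E; rewrite mulrAC divfK// gt_eqF.
Qed.
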